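(* Let $\epsilon,\delta,\alpha\in(0,1)$. Consider the following dynamic trace estimation problem: $A_1,\dots,A_m$ are real $n\times n$ matrices satisfying $\|A_i\|_F\le 1$ for all $i\in\{1,\dots,m\}$ and $\|A_{i+1}-A_i\|_F\le\alpha$ for all $i\in\{1,\dots,m-1\}$; they can be accessed only through matrix-vector products, in sequence; the goal is to output numbers $t_1,\dots,t_m$ such that for every $i\in\{1,\dots,m\}$, $$\Pr\big[|t_i-\mathrm{tr}(A_i)|\ge\epsilon\big]\le\delta.$$ Then the DeltaShift algorithm (described in the context), run with damping factor $\gamma=\alpha$, $\ell_0=O\!\left(\frac{\log(1/\delta)}{\epsilon^2}\right)$ and $\ell=O\!\left(\frac{\alpha\log(1/\delta)}{\epsilon^2}\right)$ (for suitable absolute constants in the $O(\cdot)$), solves this problem, i.e. its outputs satisfy $\Pr[|t_i-\mathrm{tr}(A_i)|\ge\epsilon]\le\delta$ for every $i$. In total it uses $$O\!\left(m\cdot\frac{\alpha\log(1/\delta)}{\epsilon^2}+\frac{\log(1/\delta)}{\epsilon^2}\right)$$ matrix-vector multiplications with $A_1,\dots,A_m$.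
   Context: $\|\cdot\|_F$ is the Frobenius norm. A Rademacher ($\pm1$) random vector in $\mathbb{R}^n$ has i.i.d. entries equal to $+1$ or $-1$ with probability $1/2$ each. The DeltaShift algorithm with inputs positive integers $\ell_0,\ell$ and damping factor $\gamma\in[0,1]$ works as follows. Draw $\ell_0$ independent Rademacher vectors $g_1,\dots,g_{\ell_0}$ and set $t_1=\frac{1}{\ell_0}\sum_{i=1}^{\ell_0}g_i^TA_1g_i$. Then for $j=2,\dots,m$: draw $\ell$ fresh independent Rademacher vectors $g_1,\dots,g_\ell$, compute $z_i=A_{j-1}g_i$ and $w_i=A_jg_i$ for $i=1,\dots,\ell$, and set $$t_j=(1-\gamma)t_{j-1}+\frac{1}{\ell}\sum_{i=1}^{\ell}g_i^T\big(w_i-(1-\gamma)z_i\big).$$ All random vectors used at different steps are independent.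
   Formalization: log(1/δ) is read as log(1/min(δ,1/2)), since the literal bounds fail as δ→1; as ℓ is a positive integer, the total count is the stated O(·) when the unrounded ℓ is at least 1, and otherwise has an extra term 2(m−1). *)

(* Defs.v *)
From mathcomp Require Import all_boot all_order all_algebra.
From mathcomp Require Import finmap.
From mathcomp Require Import all_classical all_reals all_analysis.

Set Implicit Arguments.
Unset Strict Implicit.
Unset Printing Implicit Defensive.

Import Order.TTheory GRing.Theory Num.Theory.

Local Open Scope classical_set_scope.
Local Open Scope ring_scope.

Definition frobenius (R : realType) (n : nat) (A : 'M[R]_n) : R :=
  Num.sqrt (\sum_i \sum_j A i j ^+ 2).

(* Only applied to positive reals, where it is the ceiling as a nat. *)
Definition nceil (R : realType) (x : R) : nat := `|Num.ceil x|%N.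

(* The quantity "log(1/delta)" of the O(.) bounds. It is ln(1/delta) for
   delta <= 1/2 and is frozen at ln 2 above: since ln(1/delta) -> 0 as
   delta -> 1, no constant multiple of ln(1/delta) / eps^2 bounds a positive
   number of samples, nor suffices for the guarantee, uniformly on (0,1). *)
Definition log_inv (R : realType) (delta : R) : R :=
  ln (Num.min delta 2^-1)^-1.

(* Computations that reach the matrices A_1, A_2, ... only through
   matrix-vector products: [Matvec j v k] asks for A_j v and continues with
   [k (A_j v)]. *)
Section MatvecPrograms.
Variables (R : realType) (n : nat).

Inductive mvprog (X : Type) : Type :=
| Ret of X
| Matvec of nat & 'cV[R]_n & ('cV[R]_n -> mvprog X).

Fixpoint bind (X Y : Type) (p : mvprog X) (f : X -> mvprog Y) : mvprog Y :=
  match p with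
  | Ret x => f x
  | Matvec j v k => Matvec j v (fun u => bind (k u) f)
  end.

Fixpoint output (X : Type) (A : nat -> 'M[R]_n) (p : mvprog X) : X :=
  match p with
  | Ret x => x
  | Matvec j v k => output A (k (A j *m v))
  end.

Fixpoint matvecs (X : Type) (A : nat -> 'M[R]_n) (p : mvprog X) : nat :=
  match p with
  | Ret _ => 0
  | Matvec j v k => (matvecs A (k (A j *m v))).+1
  end.

Fixpoint prog_sum (F : nat -> mvprog R) (l : nat) : mvprog R :=
  if l is l'.+1 then
    bind (prog_sum F l') (fun s => bind (F l') (fun x => Ret (s + x)))
  else Ret 0.

End MatvecPrograms.

Arguments Ret {R n X} _.

(* DeltaShift. [g j i] is the i-th random vector (i counted from 0) drawn at
   step j, the step that computes t_j (j counted from 1). *)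
Section DeltaShift.
Variables (R : realType) (n : nat) (g : nat -> nat -> 'cV[R]_n).
Variables (l0 l : nat) (gamma : R).

Let dot (u v : 'cV[R]_n) : R := (u^T *m v) 0 0.

Definition deltashift_init : mvprog R n R :=
  bind (prog_sum (fun i => Matvec 1 (g 1 i) (fun u => Ret (dot (g 1 i) u))) l0)
       (fun s => Ret (l0%:R^-1 * s)).

Definition deltashift_step (j : nat) (t : R) : mvprog R n R :=
  bind (prog_sum (fun i =>
          Matvec j.-1 (g j i) (fun z =>
          Matvec j (g j i) (fun w =>
          Ret (dot (g j i) (w - (1 - gamma) *: z))))) l)
       (fun s => Ret ((1 - gamma) * t + l%:R^-1 * s)).

Fixpoint deltashift_loop (steps j : nat) (t : R) : mvprog R n (seq R) :=
  if steps is k.+1 then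
    bind (deltashift_step j t) (fun t' =>
    bind (deltashift_loop k j.+1 t') (fun ts => Ret (t' :: ts)))
  else Ret [::].

(* Returns the sequence [:: t_1; ...; t_m], for m >= 1. *)
Definition deltashift (m : nat) : mvprog R n (seq R) :=
  bind deltashift_init (fun t1 =>
  bind (deltashift_loop m.-1 2 t1) (fun ts => Ret (t1 :: ts))).

End DeltaShift.

Definition mutually_independent (R : realType) (d : measure_display)
    (T : measurableType d) (P : probability T R) (I : choiceType) (D : set I)
    (X : I -> {RV P >-> R}) : Prop :=
  forall (J : {fset I}) (B : I -> set R),
    [set` J] `<=` D -> (forall i, measurable (B i)) ->
    P (\bigcap_(i in [set` J]) (X i @^-1` B i)) =
    (\prod_(i <- J) P (X i @^-1` B i))%E.

Definition rademacher (R : realType) (d : measure_display)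
    (T : measurableType d) (P : probability T R) (X : {RV P >-> R}) : Prop :=
  P (X @^-1` [set 1]) = (2^-1)%:E /\ P (X @^-1` [set -1]) = (2^-1)%:E.

(* The triples (j, i, k) such that the k-th entry of the i-th random vector of
   step j is used in a run of m steps. *)
Definition drawn (n l0 l m : nat) : set (nat * nat * 'I_n) :=
  [set x | (1 <= x.1.1 <= m)%N /\ (x.1.2 < if x.1.1 == 1%N then l0 else l)%N].

(* [g (j, i, k)] is the k-th entry of the i-th random vector of step j. The
   entries of a Rademacher vector are independent, and so are all the vectors
   of all the steps: hence the whole family of entries is independent. *)
Definition rademacher_draws (R : realType) (d : measure_display)
    (T : measurableType d) (P : probability T R) (n l0 l m : nat)
    (g : nat * nat * 'I_n -> {RV P >-> R}) : Prop :=
  (forall x, drawn l0 l m x -> rademacher (g x)) /\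
  mutually_independent (drawn l0 l m) g.

Definition draw_vec (R : realType) (d : measure_display)
    (T : measurableType d) (P : probability T R) (n : nat)
    (g : nat * nat * 'I_n -> {RV P >-> R}) (w : T) (j i : nat) : 'cV[R]_n :=
  \col_k g (j, i, k) w.

(* Main.v *)
Require Import Defs.
From mathcomp Require Import all_boot all_order all_algebra.
From mathcomp Require Import finmap ring lra.
From mathcomp Require Import all_classical all_reals all_analysis.
From mathcomp Require Import measurable_realfun.

Set Implicit Arguments.
Unset Strict Implicit.
Unset Printing Implicit Defensive.

Import Order.TTheory GRing.Theory Num.Theory.

Local Open Scope classical_set_scope.
Local Open Scope ring_scope.

(** The error of t_i is a sum of independent Rademacher chaoses
    g^T M g - tr M, with weight (1 - gamma)^(i-k) / l on the ones drawn at
    step k, where M = A_k - (1 - gamma) A_(k-1) has squared Frobenius norm at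
    most 4 alpha^2.  The geometric decay of the weights bounds the total
    variance proxy by 1 / l0 + 4 alpha / l, and a Chernoff bound concludes.

    The moment generating function of one chaos is bounded by
    exp (8 |M|_F^2) as soon as |M|_F <= 1/32, by induction on the dimension:
    averaging over one sign replaces a linear form c.x by
    cosh (c.x) <= exp (2 (c.x)^2), and 2 (c.x)^2 is the quadratic form of
    2 c c^T, which is added to the matrix of the remaining signs.  The row and
    the column removed from M pay for both the trace and the Frobenius norm of
    this rank one term. *)

(** * Exponential inequalities in one variable *)

Lemma expR_le_invD (R : realType) (y : R) : y < 1 -> expR y <= (1 - y)^-1.
Proof.
move=> y1; rewrite -[y]opprK expRN opprK lef_pV2 ?posrE ?expR_gt0 ?subr_gt0//.
exact: expR_ge1Dx.
Qed.

(** For [y ^+ 2 <= 1/4], the bounds [expR y <= 1 / (1 - y)] and [expR (- y) <= 1 / (1 + y)] add up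
    to [2 / (1 - y ^+ 2)], at most [2 * (1 + 2 * y ^+ 2)]. Otherwise [|y| <= 2 * y ^+ 2], and each
    exponential is bounded separately. *)
Lemma cosh_le_expR (R : realType) (y : R) :
  expR y + expR (- y) <= 2 * expR (2 * y ^+ 2).
Proof.
have [y2|y2] := lerP (y ^+ 2) 4^-1.
- have y1 : -1 < y < 1 by apply/andP; split; nra.
  have /andP[ym yp] := y1.
  have h1 : expR y <= (1 - y)^-1 by apply: expR_le_invD.
  have h2 : expR (- y) <= (1 + y)^-1.
    by rewrite -[X in 1 + X]opprK; apply: expR_le_invD; lra.
  have := expR_ge1Dx (2 * y ^+ 2).
  suff : (1 - y)^-1 + (1 + y)^-1 <= 2 * (1 + 2 * y ^+ 2) by lra.
  have -> : (1 - y)^-1 + (1 + y)^-1 = 2 / (1 - y ^+ 2).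
    by field; do ?[apply/andP; split]; rewrite gt_eqF//; nra.
  rewrite ler_pdivrMr; nra.
- suff [h1 h2] : expR y <= expR (2 * y ^+ 2) /\ expR (- y) <= expR (2 * y ^+ 2).
    lra.
  by split; rewrite ler_expR; nra.
Qed.

(** * Moment generating function of one Rademacher chaos, as a sum over sign vectors *)

Definition sgn {R : realType} (b : bool) : R := if b then 1 else -1.

Lemma sgn_sqr (R : realType) (b : bool) : (sgn b : R) ^+ 2 = 1.
Proof. by case: b; rewrite /sgn ?sqrrN expr1n. Qed.

Lemma sgn_inj (R : realType) : injective (@sgn R).
Proof. by case=> -[]; rewrite /sgn => // h; exfalso; lra. Qed.

(** Matrices are plain functions here, so that deleting a row and a column or adding a rank one term
    is just another function. Signs square to 1, hence the diagonal cancels against the trace. *)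
Definition chaos {R : realType} {n} (M : 'I_n -> 'I_n -> R)
    (x : {ffun 'I_n -> bool}) : R :=
  \sum_i \sum_j M i j * (sgn (x i) * sgn (x j)) - \sum_i M i i.

Definition sqsum {R : realType} {n} (M : 'I_n -> 'I_n -> R) : R :=
  \sum_i \sum_j M i j ^+ 2.

Lemma sqsum_ge0 (R : realType) n (M : 'I_n -> 'I_n -> R) : 0 <= sqsum M.
Proof. by do 2 (apply: sumr_ge0 => ? _); exact: sqr_ge0. Qed.

Definition ffcons {n} (b : bool) (x : {ffun 'I_n -> bool}) :
    {ffun 'I_n.+1 -> bool} :=
  [ffun i => if unlift ord0 i is Some j then x j else b].

Lemma ffcons0 n b (x : {ffun 'I_n -> bool}) : ffcons b x ord0 = b.
Proof. by rewrite ffunE unlift_none. Qed.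

Lemma ffconsS n b (x : {ffun 'I_n -> bool}) i :
  ffcons b x (lift ord0 i) = x i.
Proof. by rewrite ffunE liftK. Qed.

Lemma sum_ffcons (R : realType) n (F : {ffun 'I_n.+1 -> bool} -> R) :
  \sum_x F x =
  \sum_(x : {ffun 'I_n -> bool}) (F (ffcons true x) + F (ffcons false x)).
Proof.
rewrite (reindex (fun p : bool * {ffun 'I_n -> bool} => ffcons p.1 p.2)).
  rewrite -(pair_bigA _ (fun b x => F (ffcons b x)))/= big_bool/=.
  by rewrite -big_split.
exists (fun x : {ffun 'I_n.+1 -> bool} =>
   (x ord0, [ffun i => x (lift ord0 i)])) => [[b x] _|x _] /=.
  by rewrite ffcons0; congr pair; apply/ffunP => i; rewrite ffunE ffconsS.
apply/ffunP => i; rewrite ffunE; case: unliftP => [j ->|->]//.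
by rewrite ffunE.
Qed.

Lemma sum2_recl (R : realType) n (F : 'I_n.+1 -> 'I_n.+1 -> R) :
  \sum_i \sum_j F i j =
  F ord0 ord0 + \sum_i (F ord0 (lift ord0 i) + F (lift ord0 i) ord0) +
  \sum_i \sum_j F (lift ord0 i) (lift ord0 j).
Proof.
rewrite big_ord_recl big_ord_recl -!addrA; congr (_ + _).
under [X in _ + X = _]eq_bigr => i _ do rewrite big_ord_recl.
by rewrite !big_split/= addrA.
Qed.

Lemma chaos_ffcons (R : realType) n (M : 'I_n.+1 -> 'I_n.+1 -> R) b x :
  chaos M (ffcons b x) =
  chaos (fun i j => M (lift ord0 i) (lift ord0 j)) x +
  sgn b * \sum_i (M ord0 (lift ord0 i) + M (lift ord0 i) ord0) * sgn (x i).
Proof.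
rewrite /chaos sum2_recl [\sum_i M i i]big_ord_recl ffcons0 -expr2 sgn_sqr mulr1.
rewrite (eq_bigr (fun i => sgn b *
    ((M ord0 (lift ord0 i) + M (lift ord0 i) ord0) * sgn (x i)))); last first.
  by move=> i _; rewrite ffconsS; ring.
rewrite -mulr_sumr.
under [X in _ + X - _ = _]eq_bigr do
  under eq_bigr do rewrite !ffconsS.
ring.
Qed.

(** The extra sum on the left is the trace of the rank one term, which [chaos] subtracts; it
    produces the factor [expR (2 * q)] in [chaos_mgf]. *)
Lemma chaos_rank1 (R : realType) n (M : 'I_n -> 'I_n -> R) (c : 'I_n -> R) x :
  chaos (fun i j => M i j + 2 * (c i * c j)) x + 2 * (\sum_i c i ^+ 2) =
  chaos M x + 2 * (\sum_i c i * sgn (x i)) ^+ 2.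
Proof.
rewrite /chaos.
have -> : \sum_i (M i i + 2 * (c i * c i)) =
    \sum_i M i i + 2 * \sum_i c i ^+ 2.
  by rewrite big_split/= mulr_sumr.
suff -> : \sum_i \sum_j (M i j + 2 * (c i * c j)) * (sgn (x i) * sgn (x j)) =
    \sum_i \sum_j M i j * (sgn (x i) * sgn (x j)) +
    2 * (\sum_i c i * sgn (x i)) ^+ 2.
  ring.
rewrite expr2 mulr_suml mulr_sumr -big_split/=; apply: eq_bigr => i _.
by rewrite !mulr_sumr -big_split/=; apply: eq_bigr => j _; ring.
Qed.

(** This is the budget released by deleting the first row and column: the corner square is dropped,
    and [(a + b) ^+ 2 <= 2 * (a ^+ 2 + b ^+ 2)]. *)
Lemma sqsum_recl (R : realType) n (M : 'I_n.+1 -> 'I_n.+1 -> R) :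
  sqsum (fun i j => M (lift ord0 i) (lift ord0 j)) +
  2^-1 * \sum_i (M ord0 (lift ord0 i) + M (lift ord0 i) ord0) ^+ 2 <= sqsum M.
Proof.
rewrite /sqsum sum2_recl addrC lerD2r.
apply: le_trans (_ : _ <= \sum_i (M ord0 (lift ord0 i) ^+ 2 +
    M (lift ord0 i) ord0 ^+ 2)) _; last by rewrite lerDr sqr_ge0.
rewrite mulr_sumr; apply: ler_sum => i _.
by have := sqr_ge0 (M ord0 (lift ord0 i) - M (lift ord0 i) ord0); nra.
Qed.

Lemma sqsum_rank1 (R : realType) n (M : 'I_n -> 'I_n -> R) (c : 'I_n -> R) :
  sqsum M <= 32^-1 ^+ 2 ->
  sqsum (fun i j => M i j + 2 * (c i * c j)) <=
  sqsum M + 8^-1 * (\sum_i c i ^+ 2) + 4 * (\sum_i c i ^+ 2) ^+ 2.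
Proof.
set q := \sum_i c i ^+ 2 => hM.
pose X := \sum_i \sum_j M i j * (c i * c j).
have qq : \sum_i \sum_j (c i * c j) ^+ 2 = q ^+ 2.
  rewrite expr2 {1}/q mulr_suml; apply: eq_bigr => i _.
  by rewrite mulr_sumr; apply: eq_bigr => j _; rewrite exprMn.
(* This expansion serves twice: at [(1, 2)] for the updated matrix, and at [(32 * q, -1)] for the
   Cauchy-Schwarz bound on [X]. *)
have E u v : \sum_i \sum_j (u * M i j + v * (c i * c j)) ^+ 2 =
    u ^+ 2 * sqsum M + 2 * u * v * X + v ^+ 2 * q ^+ 2.
  rewrite -qq /sqsum /X !mulr_sumr -!big_split/=; apply: eq_bigr => i _.
  rewrite !mulr_sumr -!big_split/=; apply: eq_bigr => j _; ring.
have -> : sqsum (fun i j => M i j + 2 * (c i * c j)) =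
    sqsum M + 4 * X + 4 * q ^+ 2.
  have := E 1 2; under eq_bigr do under eq_bigr do rewrite mul1r.
  by rewrite /sqsum => ->; ring.
rewrite lerD2r lerD2l.
have q0 : 0 <= q by apply: sumr_ge0 => i _; exact: sqr_ge0.
(* Cauchy-Schwarz in AM-GM form, with the optimal scaling for
   |M|_F = 1/32. *)
have : 0 <= \sum_i \sum_j (32 * q * M i j + (-1) * (c i * c j)) ^+ 2.
  by do 2 (apply: sumr_ge0 => ? _); exact: sqr_ge0.
rewrite E => h.
(* The square only yields [q * X <= q ^+ 2 / 32]. Dividing by [q] needs [q > 0]; when [q = 0], [c]
   vanishes and so does [X]. *)
have [q_gt0|] := ltrP 0 q; first by nra.
move=> q_le0; have q_eq0 : q = 0 by apply/eqP; rewrite eq_le q_le0.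
suff -> : X = 0 by lra.
have c0 i : c i = 0.
  have := psumr_eq0P (fun i _ => sqr_ge0 (c i)) q_eq0.
  by move=> /(_ i isT)/eqP; rewrite sqrf_eq0 => /eqP.
by rewrite /X big1// => i _; rewrite big1// => j _; rewrite c0 mul0r mulr0.
Qed.

Lemma chaos_mgf (R : realType) n (M : 'I_n -> 'I_n -> R) :
  sqsum M <= 32^-1 ^+ 2 ->
  \sum_x expR (chaos M x) <= 2 ^+ n * expR (8 * sqsum M).
Proof.
elim: n M => [|n IH] M hM.
  rewrite (eq_bigr (fun=> 1)).
    rewrite sumr_const card_ffun card_ord expr0 mul1r.
    by rewrite /sqsum big_ord0 mulr0 expR0.
  by move=> x _; rewrite /chaos !big_ord0 subrr expR0.
rewrite sum_ffcons.
set M' := fun i j => M (lift ord0 i) (lift ord0 j).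
pose c i := M ord0 (lift ord0 i) + M (lift ord0 i) ord0.
pose q := \sum_i c i ^+ 2.
pose M2 i j := M' i j + 2 * (c i * c j).
have hS : sqsum M' + 2^-1 * q <= sqsum M by exact: sqsum_recl.
have q0 : 0 <= q by apply: sumr_ge0 => i _; exact: sqr_ge0.
have M'0 := sqsum_ge0 M'.
have hM' : sqsum M' <= 32^-1 ^+ 2 by lra.
have h2 : sqsum M2 <= sqsum M' + 8^-1 * q + 4 * q ^+ 2 by exact: sqsum_rank1.
(* Since [q <= 1/512], [4 * q ^+ 2 <= q / 8]; the update thus costs at most [q / 4] of the [q / 2]
   released. The remaining [q / 4], multiplied by 8, pays exactly for the factor [expR (2 * q)]. *)
have h3 : sqsum M2 + 4^-1 * q <= sqsum M by nra.
apply: (@le_trans _ _ (\sum_x 2 * (expR (2 * q) * expR (chaos M2 x)))).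
  apply: ler_sum => x _; rewrite !chaos_ffcons -/M' /= mul1r mulN1r.
  rewrite -expRD [2 * q + _]addrC chaos_rank1 !expRD -mulrDr mulrCA.
  by rewrite ler_pM2l ?mulr_gt0 ?expR_gt0//; exact: cosh_le_expR.
rewrite -mulr_sumr -mulr_sumr exprS -mulrA ler_pM2l//.
have hM2 : sqsum M2 <= 32^-1 ^+ 2 by lra.
apply: (le_trans (ler_wpM2l (expR_ge0 _) (IH M2 hM2))).
by rewrite mulrCA ler_pM2l ?exprn_gt0// -expRD ler_expR; lra.
Qed.

(** * From probabilities to counting sign patterns *)

Section SignAtoms.
Variables (R : realType) (d : measure_display) (T : measurableType d).
Variables (P : probability T R) (I : choiceType) (D : set I).
Variables (g : I -> {RV P >-> R}) (J : finType) (idx : J -> I).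
Hypotheses (indep : mutually_independent D g) (idx_inj : injective idx).
Hypothesis idxD : forall x, D (idx x).
Hypothesis rad : forall x, rademacher (g (idx x)).

Definition sign_atom (s : J -> bool) : set T :=
  \bigcap_(x in [set: J]) (g (idx x) @^-1` [set sgn (s x)]).

Lemma measurable_sign_atom s : measurable (sign_atom s).
Proof.
apply: fin_bigcap_measurable; first exact: finite_finset.
move=> x _; rewrite -[X in measurable X]setTI.
exact: (measurable_funP (g (idx x))).
Qed.

Lemma sign_atom_prob s : P (sign_atom s) = ((2 ^+ #|J|)^-1)%:E.
Proof.
(* Independence concerns events indexed by [I], so the pattern [s] is transported along [idx];
   injectivity of [idx] makes the picked preimage the right one. *)
pose B (y : I) : set R :=
  if [pick x | idx x == y] is Some x then [set sgn (s x)] else setT.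
have BE x : B (idx x) = [set sgn (s x)].
  rewrite /B; case: pickP => [x' /eqP/idx_inj -> //|/(_ x)].
  by rewrite eqxx.
pose K : {fset I} := [fset idx x | x in J]%fset.
have KD : [set` K] `<=` D by move=> y /= /imfsetP[x _ ->].
have mB y : measurable (B y) by rewrite /B; case: pickP.
have := indep KD mB.
rewrite big_imfset/=; last by move=> x y _ _; exact: idx_inj.
have -> : \bigcap_(i in [set` K]) (g i @^-1` B i) = sign_atom s.
  apply/seteqP; split => w h.
    move=> x _; rewrite -BE; apply: h => /=; apply/imfsetP; by exists x.
  move=> y /= /imfsetP[x _ ->]; rewrite /= -/(B (idx x)).
  have := h x Logic.I; by rewrite -BE.
move=> ->.
rewrite big_enum/= (eq_bigr (fun=> (2^-1)%:E)).
  by rewrite prodEFin prodr_const exprVn.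
by move=> x _; rewrite BE; case: (rad x) => h1 h2; case: (s x).
Qed.

(** [S] may be any convenient type of patterns: injectivity of [ev] and the cardinality of [S] make
    it an enumeration of all sign assignments on [J]. *)
Lemma sign_event_prob (S : finType) (ev : S -> J -> bool) (e : pred S)
    (E : set T) :
  injective ev -> #|S| = (2 ^ #|J|)%N -> measurable E ->
  (forall s w, sign_atom (ev s) w -> E w -> e s) ->
  (P E <= (#|e|%:R / 2 ^+ #|J|)%:E)%E.
Proof.
move=> ev_inj cardS mE hE.
(* Bounding P (~` E) from below by the atoms outside of [e] only requires the
   atoms to be disjoint, not that they cover almost all of the space. *)
pose U := \bigcup_(s in [set s | ~~ e s]) sign_atom (ev s).
have mU : measurable U.
  apply: fin_bigcup_measurable; first exact: finite_finset.
  by move=> s _; exact: measurable_sign_atom.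
have UE : U `<=` ~` E.
  by move=> w [s /= /negP es aw] Ew; apply: es; exact: hE aw Ew.
have PU : P U = (#|predC e|%:R / 2 ^+ #|J|)%:E.
  rewrite /U measure_fin_bigcup.
  - rewrite (eq_fsbigr (fun=> ((2 ^+ #|J|)^-1)%:E)); last first.
      by move=> s _; exact: sign_atom_prob.
    rewrite fsbig_finite/=; last exact: finite_finset.
    rewrite (perm_big (enum (predC e)))/=; last first.
      apply: uniq_perm; rewrite ?fset_uniq ?enum_uniq// => s.
      rewrite in_fset_set ?mem_enum; last exact: finite_finset.
      by apply/idP/idP; rewrite inE.
    by rewrite big_enum/= sumEFin sumr_const mulr_natl.
  - exact: finite_finset.
  - move=> s t _ _ [w [hs ht]]; apply: ev_inj; apply/funext => x.
    have := hs x Logic.I; have := ht x Logic.I; by rewrite /= => -> /sgn_inj.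
  - by move=> s _; exact: measurable_sign_atom.
have : (P U <= 1 - P E)%E.
  rewrite -probability_setC//; apply: le_measure => //; rewrite inE//.
  exact: measurableC.
rewrite PU; have := cardC e; rewrite cardS => hc.
have pJ : 0 < 2 ^+ #|J| :> R by rewrite exprn_gt0.
have fE : P E \is a fin_num by exact: fin_num_measure.
rewrite -(fineK fE) -EFinB !lee_fin => h.
have hc' : #|predC e|%:R = 2 ^+ #|J| - #|e|%:R :> R.
  by rewrite -natrX -hc natrD addrAC subrr add0r.
by move: h; rewrite hc' mulrBl divff ?gt_eqF//; lra.
Qed.

End SignAtoms.

(** * Chernoff bound for sums of independent chaoses *)

Lemma chaosZ (R : realType) n (a : R) (M : 'I_n -> 'I_n -> R) x :
  chaos (fun i j => a * M i j) x = a * chaos M x.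
Proof.
rewrite /chaos mulrBr !mulr_sumr; congr (_ - _); apply: eq_bigr => i _.
by rewrite mulr_sumr; apply: eq_bigr => j _; rewrite -mulrA.
Qed.

Lemma sqsumZ (R : realType) n (a : R) (M : 'I_n -> 'I_n -> R) :
  sqsum (fun i j => a * M i j) = a ^+ 2 * sqsum M.
Proof.
rewrite /sqsum mulr_sumr; apply: eq_bigr => i _.
by rewrite mulr_sumr; apply: eq_bigr => j _; rewrite exprMn.
Qed.

(** The summands use disjoint blocks of signs, so the sum over all patterns factors into one sum per
    block, to which [chaos_mgf] applies with the matrix [s * W p]. *)
Lemma chaos_sum_mgf (R : realType) n (J : finType)
    (W : J -> 'I_n -> 'I_n -> R) (s : R) :
  (forall p, s ^+ 2 * sqsum (W p) <= 32^-1 ^+ 2) ->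
  \sum_(x : {ffun J -> {ffun 'I_n -> bool}})
    expR (s * \sum_p chaos (W p) (x p)) <=
  2 ^+ (#|J| * n) * expR (8 * s ^+ 2 * \sum_p sqsum (W p)).
Proof.
move=> hW.
under eq_bigr => x _.
  rewrite mulr_sumr expR_sum.
  under eq_bigr => p _ do rewrite -chaosZ.
  over.
rewrite -(bigA_distr_bigA (fun p y =>
  expR (chaos (fun i j => s * W p i j) y)))/=.
rewrite mulnC exprM -prodr_const mulr_sumr expR_sum -big_split/=.
apply: ler_prod => p _; apply/andP; split.
  by apply: sumr_ge0 => x _; exact: expR_ge0.
by rewrite -mulrA -sqsumZ; apply: chaos_mgf; rewrite sqsumZ.
Qed.

(** The indicator of [eps <= F x] is at most [expR (s * (F x - eps))]. *)
Lemma chernoff_count (R : realType) (S : finType) (F : S -> R) (s eps : R) :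
  0 <= s ->
  #|[pred x | eps <= F x]|%:R <= expR (- (s * eps)) * \sum_x expR (s * F x).
Proof.
move=> s0; rewrite mulr_sumr -sum1_card natr_sum big_mkcond/=.
apply: ler_sum => x _; rewrite -expRD inE; case: ifP => [h|_].
  by rewrite -expR0 ler_expR addrC subr_ge0 ler_wpM2l.
exact: expR_ge0.
Qed.

Lemma chaos_sum_tail (R : realType) n (J : finType)
    (W : J -> 'I_n -> 'I_n -> R) (s eps : R) :
  0 <= s -> (forall p, s ^+ 2 * sqsum (W p) <= 32^-1 ^+ 2) ->
  #|[pred x : {ffun J -> {ffun 'I_n -> bool}} |
      eps <= `|\sum_p chaos (W p) (x p)| ]|%:R <=
  2 ^+ (#|J| * n) *
    (2 * expR (8 * s ^+ 2 * (\sum_p sqsum (W p)) - s * eps)).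
Proof.
move=> s0 hW.
pose F (x : {ffun J -> {ffun 'I_n -> bool}}) := \sum_p chaos (W p) (x p).
set V := \sum_p sqsum (W p).
have hN : (#|[pred x | (eps <= `|F x|)%R]| <=
    #|[pred x | (eps <= F x)%R]| + #|[pred x | (eps <= - F x)%R]|)%N.
  rewrite -cardUI; apply: leq_trans (leq_addr _ _).
  apply: subset_leq_card; apply/fintype.subsetP => x; rewrite !inE.
  by rewrite ler_normr.
(* Taking [r = s] and [r = - s] handles both tails, because the bound on the moment generating
   function sees only [r ^+ 2]. *)
have b r : r ^+ 2 = s ^+ 2 -> expR (- (s * eps)) * \sum_x expR (r * F x) <=
    2 ^+ (#|J| * n) * expR (8 * s ^+ 2 * V - s * eps).
  move=> rs; rewrite addrC expRD [2 ^+ _ * _]mulrCA ler_pM2l ?expR_gt0//.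
  by rewrite -rs; apply: chaos_sum_mgf => p; rewrite rs.
have h1 := le_trans (@chernoff_count _ _ F s eps s0) (b s erefl).
have h2 : #|[pred x | eps <= - F x]|%:R <=
    2 ^+ (#|J| * n) * expR (8 * s ^+ 2 * V - s * eps).
  apply: le_trans (@chernoff_count _ _ (fun x => - F x) s eps s0) _.
  under eq_bigr do rewrite mulrN -mulNr.
  by apply: b; rewrite sqrrN.
apply: (@le_trans _ _ ((#|[pred x | (eps <= F x)%R]| +
   #|[pred x | (eps <= - F x)%R]|)%:R)); first by rewrite ler_nat.
by rewrite natrD; lra.
Qed.

(** * Outputs and costs of the programs, and the error of the estimates *)

Lemma output_bind (R : realType) n (X Y : Type) (A : nat -> 'M[R]_n)
    (p : mvprog R n X) (f : X -> mvprog R n Y) :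
  output A (bind p f) = output A (f (output A p)).
Proof. by elim: p => //= j v k IH. Qed.

Lemma matvecs_bind (R : realType) n (X Y : Type) (A : nat -> 'M[R]_n)
    (p : mvprog R n X) (f : X -> mvprog R n Y) :
  matvecs A (bind p f) = (matvecs A p + matvecs A (f (output A p)))%N.
Proof. by elim: p => //= j v k IH; rewrite IH. Qed.

Lemma output_prog_sum (R : realType) n (A : nat -> 'M[R]_n) F l :
  output A (prog_sum F l) = \sum_(i < l) output A (F i).
Proof.
elim: l => [|l IH]; first by rewrite big_ord0.
by rewrite big_ord_recr/= !output_bind/= IH.
Qed.

Lemma matvecs_prog_sum (R : realType) n (A : nat -> 'M[R]_n) F l c :
  (forall i, matvecs A (F i) = c) -> matvecs A (prog_sum F l) = (l * c)%N.
Proof.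
move=> Fc; elim: l => [//|l IH].
by rewrite /= !matvecs_bind/= IH Fc addn0 mulSn addnC.
Qed.

Section DeltaShiftRun.
Variables (R : realType) (n : nat) (A : nat -> 'M[R]_n).
Variables (g : nat -> nat -> 'cV[R]_n) (l0 l : nat) (gamma : R).

Definition qform (M : 'M[R]_n) (v : 'cV[R]_n) : R := (v^T *m (M *m v)) 0 0.

(** The initial estimate is treated as step 0, with no previous matrix to subtract, so that all
    steps share one recursion. *)
Definition shift_mx (k : nat) : 'M[R]_n :=
  if k is k'.+1 then A k.+1 - (1 - gamma) *: A k else A 1.

Definition shift_size (k : nat) : nat := if k is 0%N then l0 else l.

(* Indices are shifted by one: [estimate k] is t_(k+1), obtained from the
   quadratic forms of [shift_mx k] at the vectors [g k.+1 r]. *)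
Fixpoint estimate (k : nat) : R :=
  (if k is k'.+1 then (1 - gamma) * estimate k' else 0) +
  (shift_size k)%:R^-1 * \sum_(r < shift_size k) qform (shift_mx k) (g k.+1 r).

Lemma output_init : output A (deltashift_init g l0) = estimate 0.
Proof. by rewrite output_bind/= output_prog_sum add0r. Qed.

Lemma output_step k t :
  output A (deltashift_step g l gamma k.+2 t) =
  (1 - gamma) * t +
  l%:R^-1 * \sum_(r < l) qform (shift_mx k.+1) (g k.+2 r).
Proof.
rewrite output_bind/= output_prog_sum/=; congr (_ + _ * _).
apply: eq_bigr => r _; rewrite /qform /=.
by rewrite mulmxBl scalemxAl.
Qed.

Lemma output_loop s k :
  output A (deltashift_loop g l gamma s k.+2 (estimate k)) =
  [seq estimate i | i <- iota k.+1 s].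
Proof.
elim: s k => [//|s IH] k.
rewrite -[deltashift_loop _ _ _ s.+1 _ _]/(bind _ (fun t => bind _ _)).
by rewrite output_bind output_step output_bind /= -IH.
Qed.

Lemma output_deltashift m : (0 < m)%N ->
  output A (deltashift g l0 l gamma m) = mkseq estimate m.
Proof.
case: m => [//|m] _; rewrite /deltashift output_bind output_init.
by rewrite output_bind output_loop.
Qed.

Lemma matvecs_loop s k t :
  matvecs A (deltashift_loop g l gamma s k t) = (s * (2 * l))%N.
Proof.
elim: s k t => [//|s IH] k t /=.
rewrite !matvecs_bind/= IH !addn0 (@matvecs_prog_sum _ _ _ _ _ 2)//.
by rewrite mulSn [(l * 2)%N]mulnC.
Qed.

(** Each vector of the first step is multiplied once; each later one is multiplied by both the
    previous and the current matrix. *)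
Lemma matvecs_deltashift m : (0 < m)%N ->
  matvecs A (deltashift g l0 l gamma m) = (l0 + m.-1 * (2 * l))%N.
Proof.
case: m => [//|m] _.
rewrite /deltashift !matvecs_bind matvecs_loop/= !addn0.
by rewrite (@matvecs_prog_sum _ _ _ _ _ 1)// muln1.
Qed.

(** By linearity of the trace, the error at one step is [1 - gamma] times the previous error plus
    the centred average of the new draws; unrolling gives the geometric weights. *)
Lemma estimate_error i : (0 < l0)%N -> (0 < l)%N ->
  estimate i - \tr (A i.+1) =
  \sum_(k < i.+1) \sum_(r < shift_size k)
    (1 - gamma) ^+ (i - k) / (shift_size k)%:R *
    (qform (shift_mx k) (g k.+1 r) - \tr (shift_mx k)).
Proof.
move=> l0_gt0 l_gt0.
(* Averaging the constant trace returns it only for a nonempty sample, as the inverse of 0 is 0. *)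
have avg k : \sum_(r < shift_size k) (shift_size k)%:R^-1 *
      (qform (shift_mx k) (g k.+1 r) - \tr (shift_mx k)) =
    (shift_size k)%:R^-1 *
      (\sum_(r < shift_size k) qform (shift_mx k) (g k.+1 r)) -
    \tr (shift_mx k).
  rewrite -mulr_sumr sumrB mulrBr sumr_const card_ord -[\tr _ *+ _]mulr_natl.
  rewrite mulKf// pnatr_eq0 -lt0n; by case: k.
elim: i => [|i IH].
  rewrite big_ord1 subnn expr0.
  by under [RHS]eq_bigr do rewrite mul1r; rewrite avg/= add0r.
rewrite big_ord_recr/= subnn expr0.
under [X in _ = _ + X]eq_bigr do rewrite mul1r.
rewrite (avg i.+1)/=.
rewrite (eq_bigr (fun k : 'I_i.+1 => (1 - gamma) * \sum_(r < shift_size k)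
    (1 - gamma) ^+ (i - k) / (shift_size k)%:R *
    (qform (shift_mx k) (g k.+1 r) - \tr (shift_mx k)))); last first.
  move=> k _; rewrite mulr_sumr; apply: eq_bigr => r _.
  by rewrite subSn ?leq_ord// exprS !mulrA.
rewrite -mulr_sumr -IH linearB/= mxtraceZ; ring.
Qed.

End DeltaShiftRun.

(** * Norms of the shifted matrices and total variance proxy *)

Lemma qform_chaos (R : realType) n (M : 'M[R]_n) (x : {ffun 'I_n -> bool})
    (v : 'cV[R]_n) :
  (forall k, v k 0 = sgn (x k)) ->
  qform M v - \tr M = chaos (fun i j => M i j) x.
Proof.
move=> vx; rewrite /qform /chaos; congr (_ - _).
rewrite mxE; apply: eq_bigr => i _; rewrite !mxE mulr_sumr.
by apply: eq_bigr => j _; rewrite !vx; ring.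
Qed.

Lemma frobenius_le (R : realType) n (M : 'M[R]_n) c :
  frobenius M <= c -> sqsum (fun i j => M i j) <= c ^+ 2.
Proof.
move=> h; have S0 := sqsum_ge0 (fun i j => M i j).
rewrite -[leLHS]sqr_sqrtr// ler_sqr ?nnegrE ?sqrtr_ge0//.
exact: le_trans (sqrtr_ge0 _) h.
Qed.

Lemma nceil_itv (R : realType) (x : R) : 0 < x ->
  x <= (nceil x)%:R <= x + 1.
Proof.
move=> x0; have /andP[h1 h2] := ceil_itv x.
have c0 : 0 <= Num.ceil x by rewrite ceil_ge0; lra.
rewrite /nceil natr_absz ger0_norm// h2/=.
by move: h1; rewrite intrB; lra.
Qed.

(** With damping [alpha], a later matrix is the increment of [A] plus [alpha] times the previous
    matrix. Both have norm at most [alpha], and the square of a sum is at most twice the sum of the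
    squares. *)
Lemma sqsum_shift_mx (R : realType) n (A : nat -> 'M[R]_n) (alpha : R) m k :
  0 < alpha < 1 ->
  (forall i, (1 <= i <= m)%N -> frobenius (A i) <= 1) ->
  (forall i, (1 <= i < m)%N -> frobenius (A i.+1 - A i) <= alpha) ->
  (k < m)%N ->
  sqsum (fun i j => shift_mx A alpha k i j) <=
  if k is 0%N then 1 else 4 * alpha ^+ 2.
Proof.
move=> /andP[a0 a1] hA hB; case: k => [|k] km /=.
  by rewrite -[leRHS](expr1n _ 2); apply/frobenius_le/hA.
have h1 := frobenius_le (hA k.+1 (ltnW km)).
have h2 := frobenius_le (hB k.+1 km).
apply: (@le_trans _ _ (2 * sqsum (fun i j => (A k.+2 - A k.+1) i j) +
   2 * alpha ^+ 2 * sqsum (fun i j => A k.+1 i j))); last by nra.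
rewrite /sqsum !mulr_sumr -big_split/=; apply: ler_sum => i _.
rewrite !mulr_sumr -big_split/=; apply: ler_sum => j _; rewrite !mxE.
have := sqr_ge0 (A k.+2 i j - A k.+1 i j - alpha * A k.+1 i j); nra.
Qed.

(** The bound [B] is preserved by each step: damping by [(1 - alpha) ^+ 2 <= 1 - alpha] frees at
    least [alpha * B], which covers the new contribution [4 * alpha ^+ 2 / l]. *)
Lemma weight_sum_le (R : realType) (alpha : R) (l0 l m : nat) (S : nat -> R) i :
  0 < alpha < 1 -> (0 < l0)%N -> (0 < l)%N ->
  (forall k, (k < m)%N -> S k <= if k is 0%N then 1 else 4 * alpha ^+ 2) ->
  (i < m)%N ->
  \sum_(k < i.+1) \sum_(r < shift_size l0 l k)
    ((1 - alpha) ^+ (i - k) / (shift_size l0 l k)%:R) ^+ 2 * S k <=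
  l0%:R^-1 + 4 * alpha / l%:R.
Proof.
move=> /andP[a0 a1] l0_gt0 l_gt0 hS.
have avg k : \sum_(r < shift_size l0 l k)
    ((shift_size l0 l k)%:R^-1) ^+ 2 * S k = (shift_size l0 l k)%:R^-1 * S k.
  rewrite sumr_const card_ord -[LHS]mulr_natl expr2 -mulrA mulVKf//.
  by rewrite pnatr_eq0 -lt0n; case: k.
have il0 : 0 < l0%:R^-1 :> R by rewrite invr_gt0 ltr0n.
have il : 0 < l%:R^-1 :> R by rewrite invr_gt0 ltr0n.
elim: i => [|i IH] im.
  rewrite big_ord1 subnn expr0.
  under eq_bigr do rewrite mul1r.
  rewrite avg/=; have := hS 0%N im; nra.
rewrite big_ord_recr/= subnn expr0.
under [X in _ + X <= _]eq_bigr do rewrite mul1r.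
rewrite (avg i.+1)/=.
rewrite (eq_bigr (fun k : 'I_i.+1 => (1 - alpha) ^+ 2 *
    \sum_(r < shift_size l0 l k)
    ((1 - alpha) ^+ (i - k) / (shift_size l0 l k)%:R) ^+ 2 * S k)); last first.
  move=> k _; rewrite mulr_sumr; apply: eq_bigr => r _.
  by rewrite subSn ?leq_ord// [_ ^+ (i - k).+1]exprS -mulrA exprMn mulrA.
rewrite -mulr_sumr.
have := IH (ltnW im); have /= := hS i.+1 im.
set v := \sum_(k < _) _ => h1 h2.
have h3 : (1 - alpha) ^+ 2 * v <= (1 - alpha) ^+ 2 * (l0%:R^-1 + 4 * alpha / l%:R).
  by rewrite ler_wpM2l ?sqr_ge0.
have h4 : l%:R^-1 * S i.+1 <= l%:R^-1 * (4 * alpha ^+ 2).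
  by apply: ler_wpM2l => //; exact: ltW.
have h5 : (1 - alpha) ^+ 2 <= 1 - alpha by nra.
have h6 : (1 - alpha) ^+ 2 * (l0%:R^-1 + 4 * alpha / l%:R) <=
    (1 - alpha) * (l0%:R^-1 + 4 * alpha / l%:R).
  apply: ler_wpM2r => //; nra.
nra.
Qed.

Lemma measurable_estimate (R : realType) (d : measure_display)
    (T : measurableType d) (P : probability T R) n (A : nat -> 'M[R]_n)
    (g : nat * nat * 'I_n -> {RV P >-> R}) l0 l gamma k :
  measurable_fun setT
    (fun w => estimate A (draw_vec g w) l0 l gamma k).
Proof.
have mq (M : 'M[R]_n) j i :
    measurable_fun setT (fun w => qform M (draw_vec g w j i)).
  rewrite (_ : (fun w => _) = (fun w => \sum_a g (j, i, a) w *
      \sum_b (M a b * g (j, i, b) w))).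
    apply: measurable_sum => a; apply: measurable_funM => //.
    by apply: measurable_sum => b; apply: measurable_funM.
  apply/funext => w; rewrite /qform mxE; apply: eq_bigr => a _.
  by rewrite !mxE; congr (_ * _); apply: eq_bigr => b _; rewrite !mxE.
elim: k => [|k IH] /=; apply: measurable_funD => //; apply: measurable_funM => //;
  by apply: measurable_sum => r.
Qed.

(** * Tail bound for one estimate *)

Section DeltaShiftTail.
Variables (R : realType) (d : measure_display) (T : measurableType d).
Variables (P : probability T R) (n m l0 l : nat) (A : nat -> 'M[R]_n).
Variables (alpha : R) (g : nat * nat * 'I_n -> {RV P >-> R}).
Hypothesis alpha01 : 0 < alpha < 1.
Hypothesis A1 : forall i, (1 <= i <= m)%N -> frobenius (A i) <= 1.
Hypothesis dA : forall i, (1 <= i < m)%N -> frobenius (A i.+1 - A i) <= alpha.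
Hypotheses (l0_gt0 : (0 < l0)%N) (l_gt0 : (0 < l)%N).
Hypothesis draws : rademacher_draws l0 l m g.

(** The two upper bounds on [s] keep each weighted matrix, scaled by [s], within Frobenius norm
    1/32: the norm is at most 1 with weight at most [1 / l0] at step 0, and at most [2 * alpha] with
    weight at most [1 / l] later. *)
Lemma estimate_tail (i : nat) (s eps : R) : (i < m)%N -> 0 <= s ->
  s <= l0%:R / 32 -> s * (2 * alpha) <= l%:R / 32 ->
  (P [set w | (eps <= `|estimate A (draw_vec g w) l0 l alpha i -
                        \tr (A i.+1)|)%R] <=
   (2 * expR (8 * s ^+ 2 * (l0%:R^-1 + 4 * alpha / l%:R) - s * eps))%:E)%E.
Proof.
move=> im s0 sl0 sl; have [rad indep] := draws.
have /andP[a0 a1] := alpha01.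
(* The sample size depends on the step, hence a dependent pair of a step and a draw; each one
   indexes a block of [n] signs. *)
pose J := {k : 'I_i.+1 & 'I_(shift_size l0 l k)}.
pose c k : R := (1 - alpha) ^+ (i - k) / (shift_size l0 l k)%:R.
pose M k := fun a b => shift_mx A alpha k a b.
pose W (p : J) := fun a b => c (tag p) * M (tag p) a b.
pose idx (x : J * 'I_n) : nat * nat * 'I_n :=
  ((tag x.1).+1, nat_of_ord (tagged x.1), x.2).
pose ev (x : {ffun J -> {ffun 'I_n -> bool}}) (y : J * 'I_n) := x y.1 y.2.
have hS k : (k < m)%N -> sqsum (M k) <= if k is 0%N then 1 else 4 * alpha ^+ 2.
  exact: sqsum_shift_mx.
have idx_inj : injective idx.
  move=> [[k r] a] [[k' r'] a'] [/val_inj ek er ea].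
  by subst k' a'; rewrite (val_inj er).
have idxD x : drawn l0 l m (idx x).
  case: x => [[k r] a]; split => /=; first exact: leq_trans (ltn_ord k) im.
  by apply: leq_trans (ltn_ord r) _; case: k {r} => -[].
have hE s' w : sign_atom g idx (ev s') w ->
    eps <= `|estimate A (draw_vec g w) l0 l alpha i - \tr (A i.+1)| ->
    eps <= `|\sum_p chaos (W p) (s' p)|.
  move=> hw; rewrite estimate_error//.
  suff -> : \sum_p chaos (W p) (s' p) = \sum_(k < i.+1)
      \sum_(r < shift_size l0 l k) c k *
      (qform (shift_mx A alpha k) (draw_vec g w k.+1 r) -
       \tr (shift_mx A alpha k)) by [].
  rewrite sig_big_dep/=; apply: eq_bigr => p _; rewrite chaosZ.
  congr (_ * _); apply/esym/qform_chaos => a.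
  by rewrite mxE; exact: (hw (p, a) Logic.I).
have sumW : \sum_p sqsum (W p) <= l0%:R^-1 + 4 * alpha / l%:R.
  under eq_bigr do rewrite sqsumZ.
  rewrite -(sig_big_dep (fun k : 'I_i.+1 => true) (fun k _ => true)
    (fun k (r : 'I_(shift_size l0 l k)) => c k ^+ 2 * sqsum (M k)))/=.
  exact: (weight_sum_le alpha01 l0_gt0 l_gt0 hS im).
have hW p : s ^+ 2 * sqsum (W p) <= 32^-1 ^+ 2.
  case: p => k r; rewrite /W sqsumZ /=.
  have km : (k < m)%N by exact: leq_trans (ltn_ord k) im.
  (* Here [v] bounds the norm of [M k]; it is instantiated with 1 at step 0 and with [2 * alpha]
     afterwards. *)
  have key v : 0 <= v -> s * v <= (shift_size l0 l k)%:R / 32 ->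
      sqsum (M k) <= v ^+ 2 -> s ^+ 2 * (c k ^+ 2 * sqsum (M k)) <= 32^-1 ^+ 2.
    move=> v0 sv hv.
    have b1 : (1 - alpha) ^+ (i - k) <= 1 by apply: exprn_ile1; lra.
    have b0 : 0 <= (1 - alpha) ^+ (i - k) by apply: exprn_ge0; lra.
    have L0 : 0 < (shift_size l0 l k)%:R :> R.
      by rewrite ltr0n; case: k {r km sv hv b1 b0} => -[].
    have sc : 0 <= s * c k * v <= 32^-1.
      rewrite !mulr_ge0 ?invr_ge0 ?(ltW L0)//=.
      have sv0 : 0 <= s * v by rewrite mulr_ge0.
      have -> : s * c k * v = (1 - alpha) ^+ (i - k) * (s * v) /
          (shift_size l0 l k)%:R by rewrite /c; ring.
      by rewrite ler_pdivrMr//; nra.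
    apply: (@le_trans _ _ ((s * c k * v) ^+ 2)).
      move: (c k) hv => y hv.
      by rewrite !exprMn -mulrA !ler_wpM2l ?sqr_ge0.
    by have /andP[sc0 sc1] := sc; rewrite ler_sqr ?nnegrE.
  have := hS k km; move: key; case: (nat_of_ord k) => [|k'] /= key h.
    by apply: (key 1) => //; rewrite ?mulr1 ?expr1n.
  by apply: (key (2 * alpha)) => //; nra.
have hcard : #|{ffun J -> {ffun 'I_n -> bool}}| =
    (2 ^ #|{: J * 'I_n}|)%N.
  by rewrite !card_ffun card_bool card_ord card_prod card_ord mulnC expnM.
have ev_inj : injective ev.
  move=> x y exy; apply/ffunP => p; apply/ffunP => a.
  by have := congr1 (fun f => f (p, a)) exy.
have mE : measurable [set w | (eps <= `|estimate A (draw_vec g w) l0 l alpha i -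
    \tr (A i.+1)|)%R].
  have mf : measurable_fun setT (fun w =>
      `|estimate A (draw_vec g w) l0 l alpha i - \tr (A i.+1)|).
    apply: measurableT_comp; first exact: normr_measurable.
    by apply: measurable_funB => //; exact: measurable_estimate.
  rewrite (_ : [set w | _] = setT `&` (fun w =>
      `|estimate A (draw_vec g w) l0 l alpha i - \tr (A i.+1)|) @^-1`
      `[eps, +oo[%classic); first exact: mf.
  by rewrite setTI; apply/seteqP; split => w /=; rewrite in_itv/= andbT.
have := sign_event_prob indep idx_inj idxD (fun x => rad _ (idxD x))
  (e := [pred x : {ffun J -> {ffun 'I_n -> bool}} |
    (eps <= `|\sum_p chaos (W p) (x p)|)%R]) ev_inj hcard mE hE.
move=> /le_trans; apply.
rewrite lee_fin card_prod card_ord ler_pdivrMr ?exprn_gt0// mulrC.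
apply: (le_trans (chaos_sum_tail eps s0 hW)).
rewrite ler_pM2l ?exprn_gt0// ler_pM2l// ler_expR lerD2r.
by apply: ler_wpM2l => //; rewrite mulr_ge0 ?sqr_ge0.
Qed.

End DeltaShiftTail.

(** * Choice of the constants and conclusion *)

Lemma log_inv_ge (R : realType) (delta : R) : 0 < delta ->
  2^-1 <= log_inv delta.
Proof.
move=> d0; rewrite /log_inv; set p := Num.min _ _.
have p0 : 0 < p by rewrite lt_min d0 invr_gt0 ltr0n.
have p2 : p <= 2^-1 by rewrite ge_min lexx orbT.
have : ln (1 + (p - 1)) <= p - 1 by apply: le_ln1Dx; lra.
by rewrite lnV ?posrE// addrCA subrr addr0; lra.
Qed.

(** With [p] the minimum of [delta] and 1/2, the left side is [2 * p ^+ 2 <= p]: the second factor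
    [p] absorbs the 2 coming from the two tails. *)
Lemma expR_log_inv (R : realType) (delta : R) : 0 < delta ->
  2 * expR (- 2 * log_inv delta) <= delta.
Proof.
move=> d0; rewrite /log_inv; set p := Num.min _ _.
have p0 : 0 < p by rewrite lt_min d0 invr_gt0 ltr0n.
have p2 : p <= 2^-1 by rewrite ge_min lexx orbT.
have pd : p <= delta by rewrite ge_min lexx.
rewrite lnV ?posrE// (_ : - 2 * - ln p = ln p + ln p); last by ring.
by rewrite expRD lnK ?posrE//; nra.
Qed.

Theorem theorem1 :
  exists C0 C1 K : nat, (0 < C0)%N /\ (0 < C1)%N /\
  forall (R : realType) (eps delta alpha : R),
    0 < eps < 1 -> 0 < delta < 1 -> 0 < alpha < 1 ->
  forall (n m : nat) (A : nat -> 'M[R]_n),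
    (1 <= m)%N ->
    (forall i, (1 <= i <= m)%N -> frobenius (A i) <= 1) ->
    (forall i, (1 <= i < m)%N -> frobenius (A i.+1 - A i) <= alpha) ->
  forall (l0 l : nat),
    l0 = nceil (C0%:R * (log_inv delta / eps ^+ 2)) ->
    l = nceil (C1%:R * (alpha * log_inv delta / eps ^+ 2)) ->
  forall (d : measure_display) (T : measurableType d) (P : probability T R)
    (g : nat * nat * 'I_n -> {RV P >-> R}),
    rademacher_draws l0 l m g ->
  let run := fun w : T => deltashift (draw_vec g w) l0 l alpha m in
  let t := fun (i : nat) (w : T) => nth 0 (output A (run w)) i.-1 in
  let cost := m%:R * (alpha * log_inv delta / eps ^+ 2)
              + log_inv delta / eps ^+ 2 in
  (forall i, (1 <= i <= m)%N ->
     (P [set w | (eps <= `|t i w - \tr (A i)|)%R] <= delta%:E)%E) /\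
  (* rounding l up to an integer costs at most two products per step *)
  (forall w, (matvecs A (run w))%:R <= K%:R * cost + (2 * m.-1)%:R) /\
  (* and is absorbed in the O(.) as soon as l is not rounded up from below 1 *)
  (1 <= C1%:R * (alpha * log_inv delta / eps ^+ 2) ->
   forall w, (matvecs A (run w))%:R <= K%:R * cost).
Proof.
(* With [X] the logarithm over [eps ^+ 2], 128 and 512 make both variance terms [1 / l0] and
   [4 * alpha / l] at most [1 / (128 * X)], and leave room for the parameter [s <= 4 * X] below. *)
exists 128%N, 512%N, 2048%N; split => //; split => //.
move=> R eps delta alpha /andP[e0 e1] /andP[d0 d1] a01 n m A m_gt0 A1 dA.
have /andP[a0 a1] := a01.
move=> l0 l l0E lE d T P g draws run t cost.
pose X := log_inv delta / eps ^+ 2.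
have lg := log_inv_ge d0.
have e2 : 0 < eps ^+ 2 by rewrite exprn_gt0.
have XE : X * eps ^+ 2 = log_inv delta by rewrite divfK ?gt_eqF.
have X0 : 2^-1 <= X by rewrite ler_pdivlMr//; nra.
have aX : alpha * log_inv delta / eps ^+ 2 = alpha * X by rewrite -mulrA.
rewrite /cost aX -/X; rewrite aX in lE; rewrite -/X in l0E.
have aX0 : 0 < alpha * X by nra.
have /andP[l0l l0u] : 128 * X <= l0%:R <= 128 * X + 1.
  by rewrite l0E; apply: nceil_itv; lra.
have /andP[ll lu] : 512 * (alpha * X) <= l%:R <= 512 * (alpha * X) + 1.
  by rewrite lE; apply: nceil_itv; lra.
have l0_gt0 : (0 < l0)%N by rewrite -(ltr0n R); lra.
have l_gt0 : (0 < l)%N by rewrite -(ltr0n R); lra.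
have mvs w : (matvecs A (run w))%:R = l0%:R + m.-1%:R * (2 * l%:R) :> R.
  by rewrite matvecs_deltashift// natrD !natrM.
have mE : m%:R = m.-1%:R + 1 :> R by rewrite -[in LHS](prednK m_gt0) -natr1.
have m0 : 0 <= m.-1%:R :> R by [].
split; last split.
- case=> [//|i] /andP[_ im].
  have tE w : t i.+1 w = estimate A (draw_vec g w) l0 l alpha i.
    by rewrite /t /run output_deltashift// nth_mkseq.
  rewrite (_ : [set w | _] = [set w | (eps <= `|estimate A (draw_vec g w) l0 l
      alpha i - \tr (A i.+1)|)%R]); last first.
    by apply: eq_set => w; rewrite tE.
  (* This minimises [s ^+ 2 / (8 * X) - s * eps], the exponent once the variance is bounded by
     [1 / (64 * X)]; the minimum is [- 2 * X * eps ^+ 2]. *)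
  pose s := 4 * X * eps.
  have s0 : 0 <= s by rewrite /s; nra.
  have hs : s <= 4 * X by rewrite /s; nra.
  have hs0 : s <= l0%:R / 32 by lra.
  have hsl : s * (2 * alpha) <= l%:R / 32 by nra.
  have := estimate_tail a01 A1 dA l0_gt0 l_gt0 draws eps im s0 hs0 hsl.
  move=> /le_trans; apply.
  rewrite lee_fin; apply: le_trans (expR_log_inv d0).
  rewrite ler_pM2l// ler_expR.
  have v1 : l0%:R^-1 <= (128 * X)^-1.
    by rewrite lef_pV2 ?posrE ?ltr0n//; lra.
  have v2 : 4 * alpha / l%:R <= (128 * X)^-1.
    rewrite ler_pdivrMr ?ltr0n// -[leLHS]mulr1 mulrC ler_pdivlMl; nra.
  have v3 : 8 * s ^+ 2 * (l0%:R^-1 + 4 * alpha / l%:R) <=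
      8 * s ^+ 2 * (2 * (128 * X)^-1).
    by apply: ler_wpM2l; [rewrite mulr_ge0 ?sqr_ge0|lra].
  apply: (le_trans (lerD v3 (lexx _))).
  rewrite (_ : 8 * s ^+ 2 * (2 * (128 * X)^-1) = 2 * (X * eps ^+ 2)); last first.
    by rewrite /s; field; rewrite gt_eqF//; lra.
  by rewrite -XE /s; lra.
(* Rounding up [l0] costs at most [1 <= 2 * X]; rounding up [l] gives the additive term. *)
- move=> w; rewrite mvs natrM mE; nra.
(* By [h], rounding at most doubles [512 * (alpha * X)], so [2 * l <= 2048 * (alpha * X)]: this
   fixes the third constant. *)
- move=> h w; rewrite mvs mE; nra.
Qed.
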